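(* Fix $y\in\mathbb{R}^n$, $\lambda\ge0$ and a function $P:\mathbb{R}^n\to\mathbb{R}$. For $\tau\in(0,1)$ define $$G^{\tau}(\theta)=\sum_{j=1}^n\rho_\tau(y_j-\theta_j)+\lambda\,P(\theta),\qquad\theta\in\mathbb{R}^n .$$ Let $0<\tau_1<\tau_2<1$ and, for $i=1,2$, let $\hat\theta^{\tau_i}$ be any minimizer of $G^{\tau_i}$ over $\mathbb{R}^n$. If $P$ is submodular, then $$\hat\theta^{\tau_1}_j\le\hat\theta^{\tau_2}_j\qquad\text{for all } j\in\{1,\dots,n\}.$$
   Context: $\rho_\tau(x)=\max\{\tau x,(\tau-1)x\}$. A function $P:\mathbb{R}^n\to\mathbb{R}$ is submodular if $P(\mathbf{x})+P(\mathbf{y})\ge P(\mathbf{x}\vee\mathbf{y})+P(\mathbf{x}\wedge\mathbf{y})$ for all $\mathbf{x},\mathbf{y}\in\mathbb{R}^n$, where $\vee$ and $\wedge$ denote coordinatewise maximum and minimum. *)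

(* Defs.v *)
From mathcomp Require Import all_boot all_order all_algebra.
From mathcomp Require Import reals.

Set Implicit Arguments.
Unset Strict Implicit.
Unset Printing Implicit Defensive.

Import Order.TTheory GRing.Theory Num.Theory.
Local Open Scope ring_scope.

Section Definitions.
Context {R : realType} {n : nat}.
Implicit Types (tau lambda t : R) (x y theta : 'rV[R]_n) (P G : 'rV[R]_n -> R).

Definition check_loss tau t : R := Num.max (tau * t) ((tau - 1) * t).

Definition vmax x y : 'rV[R]_n := \row_j Num.max (x 0 j) (y 0 j).

Definition vmin x y : 'rV[R]_n := \row_j Num.min (x 0 j) (y 0 j).

Definition submodular P : Prop :=
  forall x y, P x + P y >= P (vmax x y) + P (vmin x y).

Definition objective y lambda P tau theta : R :=
  (\sum_(j < n) check_loss tau (y 0 j - theta 0 j)) + lambda * P theta.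

Definition is_minimizer G theta : Prop := forall theta', G theta <= G theta'.

End Definitions.

(* Main.v *)
(** Submodularity allows comparing [theta1] with [theta1 /\ theta2] at level
    [tau1], and [theta2] with [theta1 \/ theta2] at level [tau2].  As
    [rho_tau2 t - rho_tau1 t = (tau2 - tau1) t], this exchange lowers the total
    loss by exactly [(tau2 - tau1) * sum_j (theta1_j - theta2_j)^+], while
    minimality says that it cannot lower the total objective; hence all the
    positive parts vanish. *)
Require Import Defs.
From mathcomp Require Import all_boot all_order all_algebra.
From mathcomp Require Import reals.
From mathcomp Require Import ring lra.

Import Order.TTheory GRing.Theory Num.Theory.
Local Open Scope ring_scope.

(** The kink [Num.max t 0] is free of [tau]; the level enters only through a linear term. *)
Lemma check_lossE (R : realType) (tau t : R) :
  check_loss tau t = Num.max t 0 + (tau - 1) * t.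
Proof. by rewrite /check_loss addr_maxl add0r; congr Num.max; ring. Qed.

(** If [a <= b], nothing moves. Otherwise [a] and [b] trade levels: the kinks cancel and only the
    linear terms leave a remainder. *)
Lemma check_loss_exchange (R : realType) (tau1 tau2 c a b : R) :
  check_loss tau1 (c - a) + check_loss tau2 (c - b) =
  check_loss tau1 (c - Num.min a b) + check_loss tau2 (c - Num.max a b)
  + (tau2 - tau1) * (Num.max a b - b).
Proof. by rewrite !check_lossE; case: (leP a b) => _; ring. Qed.

(** The losses balance exactly, coordinate by coordinate; the inequality comes from the penalty
    alone. *)
Lemma objective_exchange (R : realType) (n : nat) (y : 'rV[R]_n)
    (lambda tau1 tau2 : R) (P : 'rV[R]_n -> R) (x z : 'rV[R]_n) :
  0 <= lambda -> submodular P ->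
  objective y lambda P tau1 (vmin x z) + objective y lambda P tau2 (vmax x z)
  + (tau2 - tau1) * \sum_(j < n) (Num.max (x 0 j) (z 0 j) - z 0 j)
  <= objective y lambda P tau1 x + objective y lambda P tau2 z.
Proof.
move=> lambda_ge0 /(_ x z) /(ler_wpM2l lambda_ge0); rewrite !mulrDr => leP.
have : \sum_(j < n) check_loss tau1 (y 0 j - x 0 j)
       + \sum_(j < n) check_loss tau2 (y 0 j - z 0 j)
     = \sum_(j < n) check_loss tau1 (y 0 j - vmin x z 0 j)
       + \sum_(j < n) check_loss tau2 (y 0 j - vmax x z 0 j)
       + (tau2 - tau1) * \sum_(j < n) (Num.max (x 0 j) (z 0 j) - z 0 j).
  rewrite mulr_sumr -!big_split; apply: eq_bigr => j _ /=.
  by rewrite !mxE check_loss_exchange.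
by rewrite /objective; lra.
Qed.

Theorem theorem3p2 (R : realType) (n : nat) (y : 'rV[R]_n) (lambda : R)
    (P : 'rV[R]_n -> R) (tau1 tau2 : R) (theta1 theta2 : 'rV[R]_n)
    (lambda_ge0 : 0 <= lambda)
    (tau1_gt0 : 0 < tau1) (tau12 : tau1 < tau2) (tau2_lt1 : tau2 < 1)
    (theta1_min : is_minimizer (objective y lambda P tau1) theta1)
    (theta2_min : is_minimizer (objective y lambda P tau2) theta2)
    (P_submod : submodular P) :
  forall j : 'I_n, theta1 0 j <= theta2 0 j.
Proof.
move=> j.
have excess_ge0 i : 0 <= Num.max (theta1 0 i) (theta2 0 i) - theta2 0 i.
  by rewrite subr_ge0 le_max lexx orbT.
have sum_le0 :
    \sum_(i < n) (Num.max (theta1 0 i) (theta2 0 i) - theta2 0 i) <= 0.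
  have := objective_exchange R n y lambda tau1 tau2 P theta1 theta2
    lambda_ge0 P_submod.
  have := theta1_min (vmin theta1 theta2).
  have := theta2_min (vmax theta1 theta2).
  move=> min2 min1 exch.
  have tau21_gt0 : 0 < tau2 - tau1 by rewrite subr_gt0.
  (* Adding [min1] and [min2] to [exch] cancels all objective values. *)
  by rewrite -(pmulr_rle0 _ tau21_gt0); lra.
have : Num.max (theta1 0 j) (theta2 0 j) - theta2 0 j <= 0.
  (* By [excess_ge0], each term is at most the whole sum. *)
  apply: le_trans sum_le0; rewrite (bigD1 j) //= lerDl.
  exact: sumr_ge0.
by rewrite subr_le0 ge_max => /andP[].
Qed.
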